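(* Assume the generalized Riemann hypothesis holds for the Dirichlet $L$-functions of all non-principal primitive imaginary quadratic characters. Then the only imaginary quadratic fields with maximal class number are $\mathbb{Q}(i)$, $\mathbb{Q}(\sqrt{-2})$, $\mathbb{Q}(\sqrt{-3})$, $\mathbb{Q}(\sqrt{-5})$ and $\mathbb{Q}(\sqrt{-6})$.
   Context: For a square-free integer $d>0$, let $K=\mathbb{Q}(\sqrt{-d})$, $D=2d$ if $d\equiv 3\pmod 4$ and $D=4d$ otherwise, and let $\chi_K$ be the quadratic (Kronecker) character of $K$, viewed modulo $D$. $K$ is said to have maximal class number if $\chi_K(i)=1$ for every integer $i$ with $1\le i\le D/2$ and $\gcd(i,D)=1$. *)

(* Defs.v *)
From HB Require Import structures.
From mathcomp Require Import all_boot all_order all_algebra.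
From mathcomp Require Import complex.
From mathcomp Require Import all_classical all_reals all_analysis.

Set Implicit Arguments.
Unset Strict Implicit.
Unset Printing Implicit Defensive.

Import Order.TTheory GRing.Theory Num.Theory.
Import numFieldNormedType.Exports.

Local Open Scope classical_set_scope.
Local Open Scope ring_scope.

Definition square_free (d : nat) : Prop :=
  (0 < d)%N /\ forall m : nat, (m ^ 2 %| d)%N -> m = 1%N.

(* The Kronecker symbol (a / p) at a prime p. *)
Definition kronecker_prime (a : int) (p : nat) : int :=
  if (p%:Z %| a)%Z then 0
  else if p == 2%N then
    if ((a %% 8)%Z == 1) || ((a %% 8)%Z == 7) then 1 else -1
  else if [exists x : 'I_p, (p%:Z %| x%:Z ^+ 2 - a)%Z] then 1 else -1.

(* The Kronecker symbol (a / n), meaningful for n > 0 only. *)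
Definition kronecker (a : int) (n : nat) : int :=
  \prod_(p <- primes n) kronecker_prime a p ^+ logn p n.

(* The discriminant of Q(sqrt(-d)), for d > 0 square-free. *)
Definition discriminant (d : nat) : int :=
  if (d %% 4 == 3)%N then - d%:Z else - (4 * d)%N%:Z.

(* A multiple of the conductor, not always equal to it. *)
Definition modulus (d : nat) : nat :=
  if (d %% 4 == 3)%N then (2 * d)%N else (4 * d)%N.

(* If d = 3 (mod 4) this is not primitive: the even integers are killed, while
   the symbol itself has odd conductor d. *)
Definition chi_K (d i : nat) : int :=
  if coprime i (modulus d) then kronecker (discriminant d) i else 0.

Definition maximal_class_number (d : nat) : Prop :=
  forall i : nat, (1 <= i <= modulus d %/ 2)%N -> coprime i (modulus d) ->
    chi_K d i = 1.

Section DirichletLFunctions.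
Variable R : realType.
Local Notation C := (R[i]).

Definition dirichlet_character (q : nat) (chi : int -> C) : Prop :=
  [/\ (0 < q)%N,
      chi 1 = 1,
      forall m n : int, chi (m * n) = chi m * chi n,
      forall n : int, chi (n + q%:Z) = chi n
    & forall n : int, (chi n != 0) = coprimez n q%:Z].

Definition principal (q : nat) (chi : int -> C) : Prop :=
  forall n : int, coprimez n q%:Z -> chi n = 1.

Definition quadratic (q : nat) (chi : int -> C) : Prop :=
  forall n : int, coprimez n q%:Z -> chi n ^+ 2 = 1.

(* Odd characters: among the non-principal primitive quadratic characters,
   those attached to imaginary quadratic fields. *)
Definition imaginary (chi : int -> C) : Prop := chi (-1) = -1.

(* chi modulo q is not induced by a character modulo a proper divisor of q. *)
Definition primitive (q : nat) (chi : int -> C) : Prop :=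
  forall (e : nat) (psi : int -> C), (e %| q)%N -> dirichlet_character e psi ->
    (forall n : int, coprimez n q%:Z -> chi n = psi n) -> e = q.

(* n ^ (- s) for n > 0 *)
Definition npow_opp (n : nat) (s : C) : C :=
  let r := expR (- complex.Re s * ln n%:R) in
  let t := - complex.Im s * ln n%:R in
  ((r * cos t) +i* (r * sin t))%C.

(* L is entire and equal to the Dirichlet series of chi on Re s > 1. For a
   non-principal chi there is exactly one such L. *)
Definition dirichlet_L (chi : int -> C) (L : C -> C) : Prop :=
  (forall s : C, derivable (L : C^o -> C^o) s 1) /\
  (forall s : C, 1 < complex.Re s ->
    series (fun n : nat => chi n.+1%:Z * npow_opp n.+1 s : C^o) @ \oo
      --> (L s : C^o)).

Definition riemann_hypothesis_for (chi : int -> C) : Prop :=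
  forall L : C -> C, dirichlet_L chi L ->
  forall s : C, 0 < complex.Re s < 1 -> L s = 0 -> complex.Re s = 2^-1.

Definition GRH_imaginary_quadratic : Prop :=
  forall (q : nat) (chi : int -> C),
    dirichlet_character q chi -> ~ principal q chi -> primitive q chi ->
    imaginary chi -> quadratic q chi -> riemann_hypothesis_for chi.

End DirichletLFunctions.

(* Main.v *)
Require Import Defs.
From mathcomp Require Import all_boot all_order all_algebra.
From mathcomp Require Import all_classical all_reals all_analysis.
From mathcomp Require Import zify.

(** A prime [p = 3 (mod 4)] not dividing [d] cannot have both [d] and [-d] as
    squares modulo [p]. Maximality makes [-d] a square modulo every odd prime
    [p <= D / 2] not dividing [d], so it is refuted by any [n = 3 (mod 4)] with
    [n <= D / 2] for which [d] is congruent modulo [n] to a square [x ^ 2] with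
    no prime factor [3 (mod 4)] in common with [d]: such an [n] has a prime
    factor [3 (mod 4)]. Explicit pairs [(n, x)] are [(d - 4, 2)] for
    [d = 3 (mod 4)]; [(d/2 - 2, 2)] or [(d/2 - 8, 4)] for [d] even; and
    [(x ^ 2 - d, x)] with [x = 2 ^ k] or [x = 5 * 2 ^ k] for [d = 1 (mod 4)]. *)

Lemma kronecker_primeE (a : int) (p : nat) :
  prime p -> kronecker a p = kronecker_prime a p.
Proof.
move=> p_pr; rewrite /kronecker primes_prime // big_seq1.
by rewrite logn_prime // eqxx GRing.expr1.
Qed.

Lemma kronecker1 (a : int) : kronecker a 1 = 1%R.
Proof. by rewrite /kronecker big_nil. Qed.

Lemma kronecker_prime_square (a : int) (p x : nat) :
  odd p -> ~~ (p%:Z %| a)%Z -> (x < p)%N -> (p%:Z %| (x%:Z ^+ 2 - a)%R)%Z ->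
  kronecker_prime a p = 1%R.
Proof.
move=> p_odd /negbTE pa ltxp px; rewrite /kronecker_prime pa.
case: eqP p_odd => [-> //|_ _].
by case: existsP => // -[]; exists (Ordinal ltxp).
Qed.

Lemma kronecker_prime_eq1 (a : int) (p : nat) :
  odd p -> kronecker_prime a p = 1%R -> exists x : nat, (p%:Z %| (x%:Z ^+ 2 - a)%R)%Z.
Proof.
rewrite /kronecker_prime; case: ifP => // _; case: eqP => [-> //|_ _].
by case: existsP => // -[x px]; exists x.
Qed.

Lemma dvdn_modulus (d p : nat) :
  prime p -> odd p -> (p %| modulus d) = (p %| d).
Proof.
move=> p_pr p_odd.
have p2 : (p %| 2) = false.
  by apply/negbTE; rewrite dvdn_prime2 //; apply: contraTneq p_odd => ->.
by rewrite /modulus; case: ifP => _; rewrite Euclid_dvdM ?(Euclid_dvdM 2 2) ?p2.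
Qed.

(** The factor 4 treats both discriminants at once: a square root of [- d] modulo [p] is doubled. *)
Lemma maximal_square_opp (d p : nat) :
  maximal_class_number d -> prime p -> odd p -> (p <= modulus d %/ 2)%N ->
  ~~ (p %| d) -> exists y : nat, p %| y ^ 2 + 4 * d.
Proof.
move=> dmax p_pr p_odd lep pd.
have cop : coprime p (modulus d) by rewrite prime_coprime // dvdn_modulus.
have := dmax p; rewrite /chi_K cop prime_gt0 // lep => /(_ isT isT).
rewrite kronecker_primeE // => /(kronecker_prime_eq1 _ _ p_odd) [x].
rewrite /discriminant; case: ifP => _; rewrite GRing.opprK => px.
  by exists (2 * x); rewrite expnMn -mulnDr dvdn_mull.
by exists x.
Qed.

(** Since [(p - 1) / 2] is odd, Fermat's little theorem and [X ^ 2 = - Y ^ 2] give [X * Y = X ^ p *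
    Y = - (X * Y ^ p) = - (X * Y)] in ['F_p], so [X] or [Y] vanishes, and then both do. *)
Lemma dvdn_add_sqr_3mod4 (p x y : nat) :
  prime p -> p %% 4 = 3 -> p %| x ^ 2 + y ^ 2 -> p %| y.
Proof.
move=> p_pr p3; pose k := p %/ 4.
have pE : p = (2 * (2 * k).+1).+1 by rewrite /k; lia.
have expE (Z : 'F_p) : (Z ^+ p = Z * (Z ^+ 2) ^+ (2 * k).+1)%R.
  by rewrite -GRing.exprM -GRing.exprS; congr GRing.exp.
have fermat (a : nat) : (a%:R ^+ p = a%:R :> 'F_p)%R.
  by rewrite -GRing.natrX -(Fp_nat_mod p_pr) fermat_little // Fp_nat_mod.
rewrite !(GRing.dvdn_pcharf (pchar_Fp p_pr)) GRing.natrD !GRing.natrX GRing.addr_eq0.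
move=> /eqP xy2; set X : 'F_p := (x%:R)%R in xy2; set Y : 'F_p := (y%:R)%R in xy2 *.
have : (X * Y == - (X * Y))%R.
  apply/eqP; rewrite -[in LHS](fermat x : X ^+ p = X)%R -[in RHS](fermat y : Y ^+ p = Y)%R.
  rewrite !expE xy2 GRing.exprNn -GRing.signr_odd.
  rewrite oddS oddM /= GRing.expr1 GRing.mulN1r GRing.mulrN GRing.mulNr.
  by rewrite -GRing.mulrA [(_ ^+ _ * _)%R]GRing.mulrC.
rewrite -GRing.addr_eq0 -GRing.mulr2n -GRing.mulr_natl GRing.mulf_eq0.
rewrite -(GRing.dvdn_pcharf (pchar_Fp p_pr)) dvdn_prime2 //.
have /negbTE -> /= : p != 2 by apply: contra_eq_neq p3 => ->.
rewrite GRing.mulf_eq0 => /orP[/eqP X0|//].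
move/eqP: xy2; rewrite X0 GRing.expr0n /= eq_sym GRing.oppr_eq0.
by rewrite GRing.expf_eq0.
Qed.

Lemma dvdn_of_square (d p x : nat) :
  maximal_class_number d -> prime p -> p %% 4 = 3 -> (p <= modulus d %/ 2)%N ->
  x ^ 2 = d %[mod p] -> p %| d.
Proof.
move=> dmax p_pr p3 lep xd; apply/negPn/negP => pd.
have p_odd : odd p by lia.
have [y py] := maximal_square_opp _ _ dmax p_pr p_odd lep pd.
(* Here [y ^ 2 = - 4 * d] and [(2 * x) ^ 2 = 4 * d] modulo [p]. *)
have p2x : p %| 2 * x.
  apply: (dvdn_add_sqr_3mod4 p y) => //; rewrite expnMn.
  by rewrite /dvdn -modnDmr -modnMmr xd modnMmr modnDmr.
have px : p %| x.
  move: p2x; rewrite Euclid_dvdM // dvdn_prime2 //.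
  by case/orP => // /eqP p2; rewrite p2 in p_odd.
by case/negP: pd; rewrite /dvdn -xd -/(p %| x ^ 2) Euclid_dvdX ?px.
Qed.

Lemma prime_divisor_3mod4 (n : nat) :
  n %% 4 = 3 -> exists p, [/\ prime p, p %% 4 = 3 & p %| n].
Proof.
elim/ltn_ind: n => n IHn n3.
have n1 : (1 < n)%N by lia.
have p_pr := pdiv_prime n1; have /dvdnP[m nE] := pdiv_dvd n.
have [p3|p3] := eqVneq (pdiv n %% 4) 3.
  by exists (pdiv n); split=> //; rewrite pdiv_dvd.
have [||q [q_pr q3 qm]] := IHn m.
- by have := prime_gt1 p_pr; nia.
(* Residues with product 3 modulo 4 are 1 and 3, so the cofactor [m] is 3. *)
- move: n3 p3; rewrite {1}nE -modnMm.
  have := ltn_pmod m (isT : 0 < 4); have := ltn_pmod (pdiv n) (isT : 0 < 4).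
  case: (m %% 4) => [|[|[|[|//]]]] //; case: (pdiv n %% 4) => [|[|[|[|//]]]] //.
by exists q; split=> //; rewrite nE dvdn_mulr.
Qed.

(** Bounding [n] also bounds its prime factors. A contradiction follows when [x] is chosen without
    prime factors 3 modulo 4. *)
Lemma common_prime_3mod4 (d n x : nat) :
  maximal_class_number d -> n %% 4 = 3 -> (n <= modulus d %/ 2)%N ->
  x ^ 2 = d %[mod n] ->
  exists p, [/\ prime p, p %% 4 = 3, p %| n, p %| d & p %| x].
Proof.
move=> dmax n3 len xd; have [p [p_pr p3 pn]] := prime_divisor_3mod4 _ n3.
have xdp : x ^ 2 = d %[mod p] by rewrite -(modn_dvdm _ pn) xd modn_dvdm.
have pd : p %| d.
  apply: dvdn_of_square xdp => //; apply: leq_trans len.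
  by apply: dvdn_leq pn; lia.
exists p; split=> //.
by move: pd; rewrite /dvdn -xdp -/(p %| x ^ 2) Euclid_dvdX // andbT.
Qed.

Lemma dvdn_exp2_3mod4 (p k : nat) : prime p -> p %% 4 = 3 -> p %| 2 ^ k = false.
Proof.
move=> p_pr p3; apply/negP; rewrite Euclid_dvdX // dvdn_prime2 //.
by case/andP => /eqP p2; rewrite p2 in p3.
Qed.

Lemma maximal_lt4_of_3mod4 (d : nat) :
  maximal_class_number d -> d %% 4 = 3 -> d < 4.
Proof.
move=> dmax d3; rewrite ltnNge; apply/negP => d4.
have mE : modulus d %/ 2 = d by rewrite /modulus d3 /= mulKn.
have [||| p [p_pr p3 _ _ p2]] := common_prime_3mod4 d (d - 4) 2 dmax.
- lia.
- by rewrite mE leq_subr.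
- by rewrite -{2}(subnK d4) modnDl.
by rewrite (dvdn_exp2_3mod4 p 1) in p2.
Qed.

Lemma modulus_half (d : nat) : d %% 4 != 3 -> modulus d %/ 2 = 2 * d.
Proof. by rewrite /modulus => /negbTE ->; lia. Qed.

Lemma maximal_even (d : nat) :
  maximal_class_number d -> d %% 4 = 2 -> d \in [:: 2; 6].
Proof.
move=> dmax d2; have mE : modulus d %/ 2 = 2 * d by rewrite modulus_half ?d2.
have witness (n k : nat) : n %% 4 = 3 -> n <= 2 * d ->
    d = 2 * n + (2 ^ k) ^ 2 -> False.
  move=> n3 nd dE; rewrite -mE in nd.
  have [|p [p_pr p3 _ _]] := common_prime_3mod4 d n (2 ^ k) dmax n3 nd.
    by rewrite dE modnMDl.
  by rewrite dvdn_exp2_3mod4.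
have [e1|e1] := eqVneq (d %% 8) 2.
  have [->//|dn2] := eqVneq d 2.
  by exfalso; apply: (witness (d %/ 2 - 2) 1); lia.
have [->//|dn6] := eqVneq d 6.
(* For [d = 14] the number [d / 2 - 8] is negative; there [5 ^ 2 = 14] modulo 11 instead. *)
have [d14|dn14] := eqVneq d 14; last first.
  by exfalso; apply: (witness (d %/ 2 - 8) 2); lia.
by have := dvdn_of_square d 11 5 dmax; rewrite mE d14 => /(_ isT erefl isT erefl).
Qed.

Lemma maximal_1mod4 (d : nat) :
  maximal_class_number d -> d %% 4 = 1 -> d \in [:: 1; 5].
Proof.
move=> dmax d1; have mE : modulus d %/ 2 = 2 * d by rewrite modulus_half ?d1.
have no_square (x : nat) : 2 %| x -> d < x ^ 2 <= 3 * d ->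
    exists p, [/\ prime p, p %% 4 = 3 & p %| x].
  move=> /dvdnP[y xE] /andP[ltd led].
  have [|||p [p_pr p3 _ _ px]] := common_prime_3mod4 d (x ^ 2 - d) x dmax.
  - by rewrite xE in ltd *; nia.
  - by rewrite mE; lia.
  - by rewrite -{1}(subnK (ltnW ltd)) modnDl.
  by exists p.
(* 22 is the least [d] with [64 <= 3 * d]: from there up to 63, [x = 8] works, so that
   [x = 5 * 2 ^ k] is only needed with [k > 0], hence even. *)
have [d_small|d_large] := ltnP d 22.
  have : d \in [:: 1; 5; 9; 13; 17; 21] by rewrite !inE; lia.
  have square d' (x : nat) : d = d' -> 2 %| x -> d' < x ^ 2 <= 3 * d' ->
      ~~ has (fun p => p %% 4 == 3) (primes x) -> False.
    move=> dE x2 dx /hasPn npx; rewrite -{d'}dE in dx.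
    have [p [p_pr p3 px]] := no_square x x2 dx.
    have /npx : p \in primes x; last by rewrite p3.
    by rewrite mem_primes p_pr px andbT; lia.
  rewrite !inE => /or4P[->|->|/eqP dE|/or3P[]/eqP dE]; rewrite ?orbT //.
  - by case: (square 9 4 dE).
  - by case: (square 13 4 dE).
  (* The only even square in the range is 36, whose root has the factor 3, but [36 - 17 = 19] is
     itself prime. *)
  - by have := dvdn_of_square d 19 6 dmax; rewrite mE dE => /(_ isT erefl isT erefl).
  (* For [d = 21], [36 - 21 = 15] shares the factor 3 with [d]. Instead, [- 84] is a non-residue
     modulo 13. *)
  have [||y] := maximal_square_opp d 13 dmax isT isT; rewrite ?mE dE //.
  rewrite /dvdn -modnDml -modnXm.
  move: (ltn_pmod y (isT : 0 < 13)); move: (y %% 13) => z.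
  by do 13![case: z => [|z] // ].
have [le_d lt_d] : 4 ^ trunc_log 4 d <= d /\ d < 4 ^ (trunc_log 4 d).+1.
  by apply/andP; apply: trunc_log_bounds; lia.
move: (trunc_log 4 d) le_d lt_d => t le_d lt_d.
have exp4 j : (2 ^ j) ^ 2 = 4 ^ j by rewrite -expnM mulnC expnM.
have [small|large] := leqP (4 ^ t.+1) (3 * d).
  have [||p [p_pr p3]] := no_square (2 ^ t.+1).
  - by rewrite expnS dvdn_mulr.
  - by rewrite exp4 lt_d small.
  by rewrite dvdn_exp2_3mod4.
(* Now [75 / 64 * d < 25 * 4 ^ (t - 2) <= 25 / 16 * d]. *)
case: t le_d lt_d large => [|[|[|t]]]; rewrite !(expnS 4) ?expn0; try lia.
move=> le_d lt_d large.
have [||p [p_pr p3]] := no_square (5 * 2 ^ t.+1).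
- by rewrite expnS mulnCA dvdn_mulr.
- by rewrite expnMn exp4 (expnS 4); lia.
rewrite Euclid_dvdM // dvdn_exp2_3mod4 // orbF dvdn_prime2 // => /eqP p5.
by rewrite p5 in p3.
Qed.

Lemma chi_K1 (d : nat) : chi_K d 1 = 1%R.
Proof. by rewrite /chi_K coprime1n kronecker1. Qed.

(** In the five fields every [i > 1] to be tested is a prime power, so one square root of the
    discriminant settles it. *)
Lemma chi_K_prime_power (d i q x : nat) :
  primes i = [:: q] -> odd q -> ~~ (q%:Z %| discriminant d)%Z -> x < q ->
  (q%:Z %| (x%:Z ^+ 2 - discriminant d)%R)%Z -> coprime i (modulus d) ->
  chi_K d i = 1%R.
Proof.
move=> iq q_odd qD ltxq qx cop; rewrite /chi_K cop /kronecker iq big_seq1.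
by rewrite (kronecker_prime_square _ _ x) // GRing.expr1n.
Qed.

Theorem theorem3p4 (R : realType) (hGRH : GRH_imaginary_quadratic R)
    (d : nat) (hd : square_free d) :
  maximal_class_number d <-> d \in [:: 1; 2; 3; 5; 6]%N.
Proof.
split=> [dmax|].
  have [d3|d3] := eqVneq (d %% 4) 3.
    by have := maximal_lt4_of_3mod4 d dmax d3; rewrite !inE; lia.
  have [d2|d2] := eqVneq (d %% 4) 2.
    by move: (maximal_even d dmax d2); rewrite !inE => /orP[] ->; rewrite ?orbT.
  have [d1|d1] := eqVneq (d %% 4) 1.
    by move: (maximal_1mod4 d dmax d1); rewrite !inE => /orP[] ->; rewrite ?orbT.
  (* Multiples of 4 are not square-free. *)
  by have /hd.2 : 2 ^ 2 %| d by rewrite /dvdn; lia.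
(* The roots used below: [- 8 = 1] modulo 3; [- 20 = 1] modulo 3 and 7; [- 24] is 1, [2 ^ 2],
   [3 ^ 2] modulo 5, 7, 11. *)
rewrite !inE => /or4P[/eqP ->|/eqP ->|/eqP ->|/orP[]/eqP ->] i.
- by case: i => [|[|[|i]]] // _ _; apply: chi_K1.
- case: i => [|[|[|[|[|i]]]]] // _ cop; first exact: chi_K1.
  by apply: (@chi_K_prime_power 2 3 3 1).
- by case: i => [|[|[|[|i]]]] // _ _; apply: chi_K1.
- case: i => [|[|[|[|[|[|[|[|[|[|[|i]]]]]]]]]]] // _ cop; first exact: chi_K1.
  + by apply: (@chi_K_prime_power 5 3 3 1).
  + by apply: (@chi_K_prime_power 5 7 7 1).
  + by apply: (@chi_K_prime_power 5 9 3 1).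
- case: i => [|[|[|[|[|[|[|[|[|[|[|[|[|i]]]]]]]]]]]]] // _ cop; first exact: chi_K1.
  + by apply: (@chi_K_prime_power 6 5 5 1).
  + by apply: (@chi_K_prime_power 6 7 7 2).
  + by apply: (@chi_K_prime_power 6 11 11 3).
Qed.
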